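(* Let $c$, $d$ and $n$ be integers with $d\neq 0$ and $n>2$. Set $$a_n=\left|(i+dj+c)^n\right|_{0\le i,j\le n-1}\quad\text{and}\quad b_n=\left|(i^2+dj^2)^n\right|_{0\le i,j\le n-1}.$$ Then $$a_n'=\frac{a_n d^{-n(n-1)/2}}{(n-2)!\,n\prod_{k=1}^n k!}\quad\text{and}\quad b_n'=\frac{b_n d^{-n(n-1)/2}}{2\prod_{k=1}^n\big(k!\,(2k-1)!\big)}$$ are integers; in particular, $d^{n(n-1)/2}n^2\mid a_n$ and $d^{n(n-1)/2}(2n)!\mid b_n$. Moreover, if $d>0$ and $c\ge 0$, then $(-1)^{n(n-1)/2}a_n>0$ and $(-1)^{n(n-1)/2}b_n>0$.
   Context: For a square matrix $[a_{ij}]_{0\le i,j\le m}$, $|a_{ij}|_{0\le i,j\le m}$ denotes its determinant. *)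

(* Defs.v *)
From mathcomp Require Import all_boot all_order all_algebra.

Set Implicit Arguments.
Unset Strict Implicit.
Unset Printing Implicit Defensive.

Import GRing.Theory Num.Theory.
Local Open Scope ring_scope.

Definition det_a (c d : int) (n : nat) : int :=
  \det (\matrix_(i < n, j < n) (i%:Z + d * j%:Z + c) ^+ n).

Definition det_b (d : int) (n : nat) : int :=
  \det (\matrix_(i < n, j < n) (i%:Z ^+ 2 + d * j%:Z ^+ 2) ^+ n).

(* The products of factorials below are taken in [nat]; the truncated
   subtractions and the division by 2 are exact for n >= 2 and k >= 1. *)
Definition det_a' (c d : int) (n : nat) : rat :=
  (det_a c d n)%:~R * d%:~R ^- (n * (n - 1) %/ 2)
  / ((n - 2)`! * n * \prod_(1 <= k < n.+1) k`!)%N%:R.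

Definition det_b' (d : int) (n : nat) : rat :=
  (det_b d n)%:~R * d%:~R ^- (n * (n - 1) %/ 2)
  / (2 * \prod_(1 <= k < n.+1) (k`! * (2 * k - 1)`!))%N%:R.

(* Main.v *)
(** Write n = m + 1. Expanding (x_i + y_j)^n by the binomial theorem and reducing
    x_i^n, y_j^n modulo the polynomials vanishing at the nodes factors the matrix
    as V(x)^T N V(y), with V a Vandermonde matrix (taken at the nodes - x_i, so that
    the coefficients of \prod_i (X + x_i) are the elementary symmetric functions
    e_k(x)) and N supported on its first row, first column and an antidiagonal of
    binomial coefficients. A Schur complement gives
      det = (-1)^(n(n-1)/2) V(x) V(y) \prod_k C(n,k) \sum_k e_k(x) e_(n-k)(y) / C(n,k).
    All terms of the sum are nonnegative for nonnegative nodes, which yields the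
    signs. For the divisibilities the Vandermonde products are products of
    factorials, and what remains to be shown is that n^2, respectively
    2n(2n-1)(2n-2), divides a small product of integers times the sum. The only
    arithmetic point is the factor 2n-1: when it is prime, \prod_(i<n) (X + i^2) is
    X^n - (-1)^(n-1) X modulo 2n-1, so the middle e_k vanish; when it is composite
    and n > 5, it divides the product of integers; n = 3, 4, 5 are computed. *)

Require Import Defs.
From mathcomp Require Import all_boot all_order all_algebra all_field.
From mathcomp Require Import zify ring.

Set Implicit Arguments.
Unset Strict Implicit.
Unset Printing Implicit Defensive.

Import Order.TTheory GRing.Theory Num.Theory.
Local Open Scope ring_scope.

(** * Determinants of antidiagonal and arrow-shaped matrices *)

Definition antidiag_mx (R : comNzRingType) m : 'M[R]_m :=
  \matrix_(i, j) (i + j == m.-1)%N%:R.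

Lemma det_antidiag (R : comNzRingType) m : \det (antidiag_mx R m) = (-1) ^+ 'C(m, 2).
Proof.
elim: m => [|m IHm]; first by rewrite det_mx00 expr0.
rewrite (expand_det_row _ ord0) (bigD1 ord_max) //= mxE add0n eqxx mul1r.
rewrite big1 ?addr0 => [|j jneq]; last first.
  rewrite mxE add0n /= (_ : (_ == _) = false) ?mul0r //.
  by apply: contraNF jneq => /eqP jm; apply/eqP/val_inj.
rewrite /cofactor add0n binS bin1 exprD mulrC; congr (_ * _).
rewrite -IHm; congr (\det _); apply/matrixP=> i j.
rewrite !mxE /= /bump leq0n leqNgt ltn_ord /=.
by case: m i j {IHm} => [[]//|m] i j; rewrite /= add1n addSn eqSS.
Qed.

(** Schur complement of the diagonal block: a unitriangular factor clears the first row and leaves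
    [a] minus the sum of the [w k * u k / c k] in the corner. *)
Lemma det_arrow_field (F : fieldType) m (a : F) (w u c : 'I_m -> F) :
    (forall k, c k != 0) ->
  \det (block_mx a%:M (\row_k w k) (\col_k u k) (diag_mx (\row_k c k)))
  = a * \prod_k c k - \sum_k w k * u k * \prod_(j | j != k) c j.
Proof.
move=> c0; pose v := \row_k (w k / c k).
have -> : block_mx a%:M (\row_k w k) (\col_k u k) (diag_mx (\row_k c k))
  = block_mx 1%:M v 0 1%:M
    *m block_mx (a%:M - v *m \col_k u k) 0 (\col_k u k) (diag_mx (\row_k c k)).
  rewrite mulmx_block !mul1mx !mul0mx ?mulmx0 !add0r subrK; congr block_mx.
  by apply/rowP=> k; rewrite mul_mx_diag !mxE divfK.
rewrite det_mulmx det_ublock !det1 !mul1r det_lblock det_diag det_mx11 !mxE eqxx.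
under [\prod__ _]eq_bigr do rewrite mxE.
rewrite mulrBl mulr_suml; congr (_ - _); apply: eq_bigr => k _.
rewrite !mxE [in LHS](bigD1 k) //=.
by rewrite mulrA; congr (_ * _); rewrite mulrAC divfK // mulrC.
Qed.

(** The Schur complement divides by [c k], so the identity is transported from [rat]. *)
Lemma det_arrow m (a : int) (w u c : 'I_m -> int) :
    (forall k, c k != 0) ->
  \det (block_mx a%:M (\row_k w k) (\col_k u k) (diag_mx (\row_k c k)))
  = a * \prod_k c k - \sum_k w k * u k * \prod_(j | j != k) c j.
Proof.
move=> c0; apply: (@intr_inj rat).
rewrite -[LHS](det_map_mx intr) map_block_mx rmorphB rmorphM /= rmorph_prod rmorph_sum /=.
rewrite map_scalar_mx.
have -> : map_mx intr (diag_mx (\row_k c k)) = diag_mx (\row_k ((c k)%:~R : rat)).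
  by rewrite map_diag_mx; congr diag_mx; apply/rowP=> k; rewrite !mxE.
have -> : map_mx intr (\row_k w k) = \row_k ((w k)%:~R : rat).
  by apply/rowP=> k; rewrite !mxE.
have -> : map_mx intr (\col_k u k) = \col_k ((u k)%:~R : rat).
  by apply/colP=> k; rewrite !mxE.
rewrite det_arrow_field => [|k]; last by rewrite intr_eq0.
congr (_ - _); apply: eq_bigr => k _.
by rewrite !rmorphM /= rmorph_prod.
Qed.

(** * Node polynomials, Vandermonde products and the determinant formula *)

(** The coefficient of degree k is the elementary symmetric function e_(n-k)(x). *)
Definition node_poly (x : nat -> int) n : {poly int} :=
  \prod_(i < n) ('X + (x i)%:P).

Definition vdm (x : nat -> int) n : int := \prod_(j < n) \prod_(i < j) (x j - x i).

Lemma det_Vandermonde_opp (x : nat -> int) n :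
  \det (Vandermonde n (\row_(i < n) - x i)) = (-1) ^+ 'C(n, 2) * vdm x n.
Proof.
rewrite det_Vandermonde /vdm.
rewrite (exchange_big_dep predT) //= -bin2_sum.
rewrite big_mkord -prodrXr /= -big_split /=; apply: eq_bigr => j _.
rewrite (big_ord_narrow (ltnW (ltn_ord j))) /=.
rewrite -[X in _ ^+ X]card_ord -prodr_const -big_split; apply: eq_bigr => i _.
by rewrite !mxE /= mulN1r opprB opprK addrC.
Qed.

Lemma node_polyE x n : node_poly x n = \prod_(i < n) ('X - (- x i)%:P).
Proof. by apply: eq_bigr => i _; rewrite polyCN opprK. Qed.

Lemma size_node_poly x n : size (node_poly x n) = n.+1.
Proof. by rewrite node_polyE size_prod_XsubC /index_enum -enumT size_enum_ord. Qed.

Lemma node_poly_monic x n : node_poly x n \is monic.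
Proof. by rewrite node_polyE monic_prod_XsubC. Qed.

(** [- x i] is a root of the monic polynomial [node_poly x n], so its n-th power reduces to lower
    ones. *)
Lemma node_pow (x : nat -> int) n (i : 'I_n) :
  (- x i) ^+ n = - \sum_(k < n) (node_poly x n)`_k * (- x i) ^+ k.
Proof.
have : (node_poly x n).[- x i] = 0.
  by rewrite node_polyE horner_prod (bigD1 i) //= hornerXsubC subrr mul0r.
rewrite horner_coef size_node_poly big_ord_recr /=.
have := monicP (node_poly_monic x n); rewrite lead_coefE size_node_poly /= => ->.
by rewrite mul1r addrC => /eqP; rewrite addr_eq0 => /eqP.
Qed.

(* Up to the factor \prod_k 'C(m + 1, k), this is the sum over all k of
   e_k(x) e_(m+1-k)(y) / 'C(m + 1, k), with the end terms k = 0, m + 1 apart. *)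
Definition det_sum m (x y : nat -> int) : int :=
  let c k := ('C(m.+1, k.+1))%:Z in
  ((node_poly x m.+1)`_0 + (node_poly y m.+1)`_0) * \prod_(k < m) c k
  + \sum_(k < m) (node_poly x m.+1)`_k.+1 * (node_poly y m.+1)`_(m - k)
      * \prod_(j < m | j != k) c j.

Lemma det_pow_sum m (x y : nat -> int) :
  \det (\matrix_(i < m.+1, j < m.+1) (x i + y j) ^+ m.+1)
  = (-1) ^+ 'C(m.+1, 2) * vdm x m.+1 * vdm y m.+1 * det_sum m x y.
Proof.
set n := m.+1; pose qx := node_poly x n; pose qy := node_poly y n.
pose c k : int := 'C(n, k.+1)%:Z.
(* [arrow] is the middle factor N with its last [m] columns reversed, which is why the coefficients
   of [qy] run backwards; [flip] undoes the reversal. *)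
pose arrow := block_mx (- (qx`_0 + qy`_0))%:M (\row_(k < m) - qy`_(m - k))
  (\col_(k < m) - qx`_k.+1) (diag_mx (\row_(k < m) c k)).
pose flip := block_mx (1%:M : 'M[int]_1) 0 0 (antidiag_mx int m).
have NE (k l : 'I_(1 + m)) : (arrow *m flip) k l
   = - ((l == 0 :> nat)%:R * qx`_k) - ((k == 0 :> nat)%:R * qy`_l)
     + (k + l == n)%N%:R * 'C(n, k)%:Z.
  rewrite mulmx_block !mulmx1 !mulmx0 !addr0 !add0r.
  case: (split_ordP k) => {}k ->; case: (split_ordP l) => {}l ->;
    rewrite ?(block_mxEul, block_mxEur, block_mxEdl, block_mxEdr) /=.
  - by rewrite !ord1 !mxE !eqxx /= !mul1r mul0r addr0 opprD.
  - rewrite ord1 !mxE (bigD1 (rev_ord l)) //= big1 => [|j jneq]; last first.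
      rewrite !mxE (_ : (j + l == _)%N = false) ?mulr0 //.
      apply: contraNF jneq => /eqP e; apply/eqP/val_inj => /=.
      by have := ltn_ord l; lia.
    have ll := ltn_ord l.
    rewrite !mxE /= (_ : (_ == m.-1) = true); last by apply/eqP; lia.
    rewrite (_ : (_ == n)%N = false); last by apply/eqP; rewrite /n; lia.
    by rewrite !mul0r !mul1r mulr1 !addr0 oppr0 add0r add1n (_ : (m - _)%N = l.+1) //; lia.
  - rewrite ord1 !mxE /= mul1r mul0r subr0.
    have kk := ltn_ord k.
    rewrite (_ : (_ == n)%N = false); last by apply/eqP; rewrite /n; lia.
    by rewrite mul0r addr0 add1n.
  rewrite mul_diag_mx !mxE /= !mul0r oppr0 !add0r mulrC; congr (_ * _).
  congr ((nat_of_bool _)%:R); have ll := ltn_ord l.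
  by apply/eqP/eqP; rewrite /n; lia.
pose V (z : nat -> int) := Vandermonde n (\row_(i < n) - z i : 'rV[int]_n).
have ME : \matrix_(i < n, j < n) (x i + y j) ^+ n
  = (-1) ^+ n *: ((V x)^T *m (arrow *m flip) *m V y).
  apply/matrixP=> i j; rewrite !mxE.
  have -> : x i + y j = -1 * (- x i + - y j) by ring.
  rewrite exprMn; congr (_ * _).
  have -> : \sum_j0 ((V x)^T *m (arrow *m flip)) i j0 * V y j0 j
    = \sum_(l < n) \sum_(k < n) (- x i) ^+ k * (- ((l == 0 :> nat)%:R * qx`_k)
        - ((k == 0 :> nat)%:R * qy`_l) + (k + l == n)%N%:R * 'C(n, k)%:Z) * (- y j) ^+ l.
    apply: eq_bigr => l _; rewrite !mxE mulr_suml; apply: eq_bigr => k _.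
    by rewrite NE !mxE.
  clear; set X : int := - x i; set Y : int := - y j.
  under [RHS]eq_bigr => l _.
    under eq_bigr do rewrite mulrDr mulrBr 2!mulrDl.
    rewrite 2!big_split /=. over.
  (* The two end terms of the binomial expansion are pure powers, reduced by [node_pow] to the first
     column and first row of N; the others form its antidiagonal. *)
  rewrite 2!big_split /= exprDn big_ord_recl big_ord_recr /= subn0 subnn.
  rewrite !expr0 mulr1 mul1r bin0 binn !mulr1n addrA addrAC; congr (_ + _ + _).
  - rewrite node_pow -/X -/qx [RHS]big_ord_recl /= [X in _ + X]big1 => [|l _]; last first.
      by rewrite big1 // => k _; rewrite mul0r oppr0 mulr0 mul0r.
    by rewrite addr0 -sumrN; apply: eq_bigr => k _; rewrite mul1r expr0 mulr1 mulrN mulrC.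
  - rewrite /bump leq0n add1n node_pow -/Y -/qy -sumrN; apply: eq_bigr => l _.
    rewrite big_ord_recl /= [X in _ + X]big1 => [|k _]; last first.
      by rewrite mul0r mulr0 oppr0 mul0r.
    by rewrite addr0 !mul1r mulNr.
  rewrite [in RHS]big_ord_recl /= [X in _ = X + _]big1 ?add0r => [|k _]; last first.
    by rewrite addn0 ltn_eqF ?ltn_ord // mul0r mulr0 mul0r.
  apply: eq_bigr => l _; rewrite (bigD1 (rev_ord (widen_ord (leqnSn m) l))) //= big1.
    have ll := ltn_ord l; rewrite addr0 /bump leq0n add1n.
    rewrite (_ : (_ == n)%N = true) ?mul1r; last by apply/eqP; rewrite /n; lia.
    rewrite -(@bin_sub n l.+1) ?subnSK //; last by rewrite /n; lia.
    by rewrite -mulr_natr natz mulrAC.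
  move=> k kneq; rewrite /bump leq0n add1n (_ : (_ == n)%N = false) ?mul0r ?mulr0 ?mul0r //.
  apply: contraNF kneq => /eqP e; apply/eqP/val_inj => /=.
  by have := ltn_ord l; move: e; rewrite /n; lia.
have detflip : \det flip = (-1) ^+ 'C(m, 2).
  by rewrite /flip det_ublock det1 mul1r det_antidiag.
have detarrow : \det arrow = - det_sum m x y.
  rewrite /arrow det_arrow => [|k]; last first.
    have : (0 < 'C(n, k.+1))%N by rewrite bin_gt0 ltnS ltnW.
    by rewrite /c; lia.
  rewrite /det_sum mulNr -opprD; congr (- (_ + _)).
  by apply: eq_bigr => k _; rewrite mulrNN [X in X * _]mulrC.
rewrite ME detZ !det_mulmx det_tr detflip detarrow !det_Vandermonde_opp -/n.
(* A scalar (-1)^n leaves an n by n determinant as (-1)^(n*n), and n*n has the parity of n. *)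
have -> : ((-1) ^+ n) ^+ n = - (-1) ^+ m :> int.
  by rewrite -exprM -signr_odd oddM andbb signr_odd exprS mulN1r.
rewrite /n binS bin1 exprD.
have s2 k : (-1) ^+ k * (-1) ^+ k = 1 :> int by rewrite -expr2 sqrr_sign.
move: (s2 m) (s2 'C(m, 2)); set s := (-1) ^+ m; set t := (-1) ^+ 'C(m, 2) => ss tt.
set Vx := vdm x _; set Vy := vdm y _; set E := det_sum m x y.
by transitivity ((s * s) * (t * t) * (t * s * Vx * Vy * E)); [ring | rewrite ss tt !mul1r].
Qed.

(** * Coefficients of node polynomials and positivity of the sum *)

Lemma coef_node_polyS (x : nat -> int) n k :
  (node_poly x n.+1)`_k
  = (if k is k'.+1 then (node_poly x n)`_k' else 0) + x n * (node_poly x n)`_k.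
Proof.
rewrite /node_poly big_ord_recr /= mulrDr coefD coefMX coefMC.
by case: k => [|k] /=; rewrite [in RHS]mulrC.
Qed.

Lemma node_poly_oversize (x : nat -> int) n k : (n < k)%N -> (node_poly x n)`_k = 0.
Proof. by move=> nk; rewrite nth_default // size_node_poly. Qed.

Lemma node_poly_lead (x : nat -> int) n : (node_poly x n)`_n = 1.
Proof. by have := monicP (node_poly_monic x n); rewrite lead_coefE size_node_poly. Qed.

Lemma node_poly_subl (x : nat -> int) n : (node_poly x n.+1)`_n = \sum_(i < n.+1) x i.
Proof.
elim: n => [|n IHn].
  by rewrite coef_node_polyS node_poly_lead big_ord1 mulr1 add0r.
by rewrite coef_node_polyS node_poly_lead mulr1 IHn [in RHS]big_ord_recr.
Qed.

Lemma node_poly_coef0 (x : nat -> int) n : x 0%N = 0 -> (node_poly x n.+1)`_0 = 0.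
Proof.
move=> x0; elim: n => [|n IHn]; rewrite coef_node_polyS add0r ?x0 ?mul0r //.
by rewrite IHn mulr0.
Qed.

(** The coefficient of degree k is homogeneous of degree n - k in the nodes. *)
Lemma node_poly_scale (d : int) (z : nat -> int) n k : (k <= n)%N ->
  (node_poly (fun i => d * z i) n)`_k = d ^+ (n - k) * (node_poly z n)`_k.
Proof.
elim: n k => [|n IHn] k; first by rewrite leqn0 => /eqP->; rewrite !node_poly_lead mul1r.
rewrite !coef_node_polyS; case: k => [|k] kn.
  by rewrite !add0r IHn // !subn0 exprS; ring.
rewrite subSS mulrDr IHn //; congr (_ + _).
have [kn'|nk] := ltnP k n; last by rewrite !node_poly_oversize ?ltnS // !mulr0.
by rewrite IHn // -(subnSK kn') exprS; ring.
Qed.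

Lemma node_poly_ge0 (x : nat -> int) n k :
  (forall i, 0 <= x i) -> 0 <= (node_poly x n)`_k.
Proof.
move=> x0; elim: n k => [|n IHn] k; first by rewrite /node_poly big_ord0 coef1 ler0n.
by rewrite coef_node_polyS addr_ge0 ?mulr_ge0 //; case: k.
Qed.

(** For k > 0 the monomials of e_(n-k) have at most n - 1 factors, so one of them avoids the
    possibly zero node [x 0]. *)
Lemma node_poly_gt0 (x : nat -> int) n k :
    0 <= x 0%N -> (forall i, 0 < x i.+1) -> (0 < k <= n)%N ->
  0 < (node_poly x n)`_k.
Proof.
move=> x0 xS; have xp i : 0 <= x i by case: i => // i; rewrite ltW.
elim: n k => [|n IHn] [|k] // /andP[_ kn]; rewrite coef_node_polyS.
case: k kn => [|k] kn; last first.
  by rewrite ltr_wpDr ?mulr_ge0 ?node_poly_ge0 ?IHn.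
case: n {kn} IHn => [|n] IHn.
  by rewrite node_poly_lead ltr_wpDr // mulr_ge0 ?node_poly_ge0.
by rewrite ltr_wpDl ?node_poly_ge0 // mulr_gt0 ?IHn.
Qed.

(** The end terms may vanish, as they contain the product of all nodes; strictness comes from the
    middle terms, whose coefficients all have positive degree. *)
Lemma det_sum_gt0 m (x y : nat -> int) :
    0 <= x 0%N -> (forall i, 0 < x i.+1) -> 0 <= y 0%N -> (forall i, 0 < y i.+1) ->
  (0 < m)%N -> 0 < det_sum m x y.
Proof.
move=> x0 xS y0 yS m0; rewrite /det_sum.
have xp i : 0 <= x i by case: i => // i; rewrite ltW.
have yp i : 0 <= y i by case: i => // i; rewrite ltW.
have cp k : (k < m)%N -> 0 < 'C(m.+1, k.+1)%:Z.
  by move=> km; have : (0 < 'C(m.+1, k.+1))%N; [rewrite bin_gt0 ltnS ltnW | lia].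
rewrite ltr_wpDl //.
  apply: mulr_ge0; first by rewrite addr_ge0 ?node_poly_ge0.
  by apply: prodr_ge0 => k _; rewrite ltW ?cp.
have tp (k : 'I_m) : 0 < (node_poly x m.+1)`_k.+1 * (node_poly y m.+1)`_(m - k)
      * \prod_(j < m | j != k) 'C(m.+1, j.+1)%:Z.
  have km := ltn_ord k.
  apply: mulr_gt0; last by apply: prodr_gt0 => j _; rewrite cp.
  by rewrite mulr_gt0 // node_poly_gt0 //; lia.
case: m m0 {cp} tp => // m _ tp; rewrite big_ord_recl ltr_wpDr ?tp //.
by apply: sumr_ge0 => k _; rewrite ltW ?tp.
Qed.

(** * Vandermonde products of the two families of nodes *)

Lemma vdm_scale (d : int) (x : nat -> int) n :
  vdm (fun i => d * x i) n = d ^+ 'C(n, 2) * vdm x n.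
Proof.
rewrite /vdm -bin2_sum big_mkord -prodrXr -big_split; apply: eq_bigr => j _ /=.
rewrite -[X in d ^+ X]card_ord -prodr_const -big_split; apply: eq_bigr => i _ /=.
by rewrite mulrBr.
Qed.

Lemma vdm_shift (c : int) (x : nat -> int) n : vdm (fun i => x i + c) n = vdm x n.
Proof. by apply: eq_bigr => j _; apply: eq_bigr => i _; ring. Qed.

Lemma prod_int_nat n (F : nat -> nat) : \prod_(i < n) (F i)%:Z = (\prod_(i < n) F i)%N%:Z.
Proof. by elim: n => [|n IHn]; rewrite ?big_ord0 // !big_ord_recr /= IHn PoszM. Qed.

Lemma prod_sub_fact j : (\prod_(i < j) (j - i) = j`!)%N.
Proof. by rewrite -ffact_prod ffactnn. Qed.

Lemma vdm_nat n : vdm (fun i => i%:Z) n = (\prod_(j < n) j`!)%N%:Z.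
Proof.
rewrite -(prod_int_nat n (fun j => j`!)); apply: eq_bigr => j _.
rewrite -prod_sub_fact -(prod_int_nat j (fun i => (j - i)%N)); apply: eq_bigr => i _.
by have := ltn_ord i; lia.
Qed.

Definition sqr_nodes (i : nat) : int := i%:Z ^+ 2.

Lemma vdm_sqr n : vdm sqr_nodes n
  = (\prod_(j < n) j`!)%N%:Z * (\prod_(j < n) \prod_(i < j) (j + i))%N%:Z.
Proof.
rewrite -vdm_nat -(prod_int_nat n (fun j => (\prod_(i < j) (j + i))%N)) -big_split.
apply: eq_bigr => j _ /=.
rewrite -(prod_int_nat j (fun i => (j + i)%N)) -big_split; apply: eq_bigr => i _ /=.
by rewrite /sqr_nodes PoszD; ring.
Qed.

Lemma det_a_eq c d m : det_a c d m.+1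
  = (-1) ^+ 'C(m.+1, 2) * d ^+ 'C(m.+1, 2) * ((\prod_(j < m.+1) j`!) ^ 2)%N%:Z
    * det_sum m (fun i => i%:Z + c) (fun i => d * i%:Z).
Proof.
rewrite /det_a; transitivity (\det (\matrix_(i < m.+1, j < m.+1) ((i%:Z + c) + d * j%:Z) ^+ m.+1)).
  by congr (\det _); apply/matrixP=> i j; rewrite !mxE addrAC.
rewrite (det_pow_sum m (fun i => i%:Z + c) (fun i => d * i%:Z)).
by rewrite vdm_shift vdm_scale !vdm_nat -mulnn PoszM; ring.
Qed.

Lemma det_b_eq d m : det_b d m.+1
  = (-1) ^+ 'C(m.+1, 2) * d ^+ 'C(m.+1, 2)
    * (((\prod_(j < m.+1) j`!) * \prod_(j < m.+1) \prod_(i < j) (j + i)) ^ 2)%N%:Z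
    * det_sum m sqr_nodes (fun i => d * sqr_nodes i).
Proof.
rewrite -[LHS]/(\det (\matrix_(i < m.+1, j < m.+1) (sqr_nodes i + (d * sqr_nodes j)) ^+ m.+1)).
rewrite (det_pow_sum m sqr_nodes (fun i => d * sqr_nodes i)).
by rewrite vdm_scale !vdm_sqr -mulnn !PoszM; ring.
Qed.

(** * Divisibility of the sum for a_n *)

Lemma dvdz_sum (d : int) (I : finType) (P : pred I) (F : I -> int) :
  (forall i, P i -> (d %| F i)%Z) -> (d %| \sum_(i | P i) F i)%Z.
Proof. exact: rpred_sum. Qed.

(** Since 2 'C(p, 2) = p (p - 1), an even [G] suffices when p > 4. For p = 3 the binomial is 3
    itself; for p = 4 the remaining product is another 'C(4, 2), and 4 divides 6 * 6. *)
Lemma dvdz_bin2 p (G : nat) (t : int) : (2 < p)%N -> (4 < p -> 2 %| G)%N ->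
    (p%:Z %| t - 'C(p, 2)%:Z)%Z ->
  (p%:Z %| G%:Z * t * \prod_(i < p - 3) 'C(p, i.+2)%:Z)%Z.
Proof.
move=> p2 pG tp; have -> : t = (t - 'C(p, 2)%:Z) + 'C(p, 2)%:Z by ring.
rewrite mulrDr mulrDl rpredD //; first by rewrite dvdz_mulr // dvdz_mull.
have [p4|] := ltnP 4 p.
  rewrite dvdz_mulr //; have /dvdnP[g ->] := pG p4.
  have e : ((g * 2)%:Z * 'C(p, 2)%:Z = g%:Z * p.-1%:Z * p%:Z).
    by have := mul_bin_diag p 1; rewrite bin1; lia.
  by rewrite e dvdz_mull.
case: p p2 {pG tp} => [|[|[|[|[|p]]]]] // _ _.
  by rewrite big_ord0 mulr1 dvdz_mull.
by rewrite big_ord1 -mulrA dvdz_mull.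
Qed.

Lemma sum_nat_bin2 n : \sum_(i < n) (i%:Z) = 'C(n, 2)%:Z.
Proof.
rewrite -bin2_sum big_mkord; elim: n => [|n IHn]; first by rewrite !big_ord0.
by rewrite !big_ord_recr /= IHn.
Qed.

(* A term omitting neither 'C(n, 1) nor 'C(n, n - 1) is divisible by n ^ 2; in the
   other two the missing factor comes from e_1(x) or e_1(y), each congruent to a
   multiple of 'C(n, 2) modulo n. *)
Lemma det_sum_a_dvd p (c d : int) :
  ((p.+3 ^ 2)%N%:Z %| (\prod_(k < p.+1) k`!)%N%:Z
     * det_sum p.+2 (fun i => i%:Z + c) (fun i => d * i%:Z))%Z.
Proof.
set n := p.+3; set G := (\prod_(k < _) _)%N; pose b k := 'C(n, k.+1)%:Z.
have G2 : (4 < n -> 2 %| G)%N.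
  case: (p) @n @G {b} => [|[|q]] // n G _.
  by rewrite /G (bigD1 (Ordinal (isT : 2 < q.+3)%N)) //= dvdn_mulr.
have b0 : b 0%N = n by rewrite /b bin1.
have bm : b p.+1 = n by rewrite /b binSn.
rewrite -mulnn PoszM /det_sum; set qx := node_poly _ _; set qy := node_poly _ _.
rewrite mulrDr rpredD //.
  rewrite !dvdz_mull // big_ord_recl big_ord_recr /= -/n.
  by rewrite -/(b 0%N) -/(b p.+1) b0 bm mulrCA -PoszM dvdz_mull ?dvdzz.
have mid : \prod_(i < p) b i.+1 = \prod_(i < n - 3) 'C(n, i.+2)%:Z.
  by rewrite /n !subSS subn0.
rewrite mulr_sumr dvdz_sum // => k _; rewrite -/n -/(b _).
have [->|k0] := eqVneq k ord0.
  have -> : \prod_(j < p.+2 | j != ord0) b j = \prod_(i < p) b i.+1 * n%:Z.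
    by rewrite big_mkcond big_ord_recl /= mul1r big_ord_recr /= bm.
  rewrite subn0 mid [X in (_ %| X)%Z](_ : _ = qx`_1
    * (G%:Z * qy`_p.+2 * \prod_(i < n - 3) 'C(n, i.+2)%:Z * n%:Z)); last by rewrite /=; ring.
  rewrite dvdz_mull // dvdz_mul //.
  rewrite node_poly_subl -mulr_sumr sum_nat_bin2 mulrCA -mulrA dvdz_mull //.
  by rewrite dvdz_bin2 // subrr dvdz0.
have [->|km] := eqVneq k ord_max.
  have -> : \prod_(j < p.+2 | j != ord_max) b j = n%:Z * \prod_(i < p) b i.+1.
    rewrite big_mkcond big_ord_recr /= eqxx mulr1 big_ord_recl /= b0; congr (_ * _).
    apply: eq_bigr => i _; rewrite ifT //.
    by apply/eqP => /(congr1 val) /= /eqP; rewrite ltn_eqF // ltnS ltn_ord.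
  rewrite mid [X in (_ %| X)%Z](_ : _ = qy`_(p.+2 - p.+1)
    * (n%:Z * (G%:Z * qx`_p.+2 * \prod_(i < n - 3) 'C(n, i.+2)%:Z))); last by rewrite /=; ring.
  rewrite dvdz_mull // dvdz_mul // dvdz_bin2 //.
  rewrite node_poly_subl big_split /= sum_nat_bin2 sumr_const card_ord addrAC subrr add0r.
  by rewrite -mulr_natr natz dvdz_mull.
rewrite !mulrA dvdz_mull // (bigD1 ord0) 1?eq_sym //= (bigD1 ord_max) /=; last first.
  by rewrite eq_sym km.
by rewrite mulrA -[(Posz _)]/(b 0%N) -[X in _ * X * _]/(b p.+1) b0 bm dvdz_mulr.
Qed.

(** * The node polynomial of the squares modulo 2n - 1 *)

(* Modulo the prime 2n - 1, the elements - i ^ 2 for i < n are distinct and are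
   roots of the right-hand side by Fermat's little theorem. *)
Lemma node_poly_sqr_Fp n : prime (2 * n).-1 -> (1 < n)%N ->
  map_poly intr (node_poly sqr_nodes n)
  = 'X^n - (-1) ^+ n.-1 *: 'X :> {poly 'F_(2 * n).-1}.
Proof.
set P := (2 * n).-1 => Ppr n1.
have chP : P \in [pchar 'F_P] by rewrite pchar_Fp.
have nat0 k : (0 < k < P)%N -> (k%:R : 'F_P) != 0.
  by move=> /andP[k0 kP]; rewrite -(dvdn_pcharf chP) gtnNdvd.
set f := 'X^n - _.
have szf : size f = n.+1.
  rewrite size_polyDl ?size_polyXn // size_polyN.
  by rewrite (leq_ltn_trans (size_scale_leq _ _)) // size_polyX.
have lcf : lead_coef f = 1.
  rewrite lead_coefDl ?lead_coefXn // size_polyXn size_polyN.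
  by rewrite (leq_ltn_trans (size_scale_leq _ _)) // size_polyX.
pose rs := [seq - (i%:R : 'F_P) ^+ 2 | i <- iota 0 n].
have rootf : all (root f) rs.
  apply/allP => _ /mapP[i _ ->]; rewrite /root !hornerE (exprNn (i%:R ^+ 2)).
  rewrite -exprM mulrN opprK.
  (* Fermat's theorem turns i^(2n) = i^(P+1) into i^2, so the two terms cancel. *)
  have -> : (2 * n = P.+1)%N by rewrite /P; lia.
  have iP : (i%:R : 'F_P) ^+ P = i%:R by have := expf_card (i%:R : 'F_P); rewrite card_Fp.
  rewrite exprS iP -expr2.
  by case: (n) n1 => // n' _; rewrite exprS /=; apply/eqP; ring.
have rsu : uniq rs.
  rewrite map_inj_in_uniq ?iota_uniq // => i j; rewrite !mem_iota !add0n /=.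
  wlog ij : i j / (i <= j)%N => [hw|] ilt jlt.
    by case/orP: (leq_total i j) => h e; [apply: hw | apply/esym/hw].
  move=> /oppr_inj /eqP; rewrite eq_sym -subr_eq0 subr_sqr mulf_eq0 -natrB // -natrD.
  (* For i < j < n, both j - i and j + i lie strictly between 0 and 2n - 1. *)
  have [->//|neq] := eqVneq i j.
  by rewrite !(negPf (nat0 _ _)) // /P; lia.
rewrite [f](@all_roots_prod_XsubC _ f rs) ?uniq_rootsE ?szf ?size_map ?size_iota //.
rewrite lcf scale1r big_map /node_poly rmorph_prod.
have -> : iota 0 n = index_iota 0 n by rewrite /index_iota subn0.
rewrite big_mkord; apply: eq_bigr => i _.
by rewrite rmorphD /= map_polyX map_polyC /= polyCN opprK /sqr_nodes rmorphXn.
Qed.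

Lemma node_poly_sqr_dvd n k : prime (2 * n).-1 -> (1 < k < n)%N ->
  (((2 * n).-1)%:Z %| (node_poly sqr_nodes n)`_k)%Z.
Proof.
move=> Ppr /andP[k1 kn]; have chP : (2 * n).-1 \in [pchar 'F_(2 * n).-1].
  by rewrite pchar_Fp.
rewrite (dvdz_pcharf chP) -coef_map /= node_poly_sqr_Fp ?(ltn_trans k1) //.
by rewrite coefB coefZ coefXn coefX (ltn_eqF kn) (gtn_eqF k1) mulr0 subr0.
Qed.

(** * Products of consecutive integers *)

(** This is the product of j + 1, ..., 2j + 1 without its first factor, which [prod_rising_fact]
    uses to build a factorial. *)
Definition half_run j := (\prod_(i < j) (j.+2 + i))%N.

Lemma dvdn_half_run v j : (j.+2 <= v <= j.*2.+1)%N -> (v %| half_run j)%N.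
Proof.
move=> /andP[jv vj]; have vlt : (v - j.+2 < j)%N by lia.
rewrite /half_run (bigD1 (Ordinal vlt)) //= subnKC //; exact: dvdn_mulr.
Qed.

Lemma dvdn_half_runs p u v i j : (i < p)%N -> (j < p)%N -> i != j ->
  (u %| half_run i -> v %| half_run j -> u * v %| \prod_(k < p) half_run k)%N.
Proof.
move=> ip jp ij ui vj; rewrite (bigD1 (Ordinal ip)) //= (bigD1 (Ordinal jp)) /=.
  by rewrite mulnA dvdn_mulr // dvdn_mul.
by rewrite -val_eqE eq_sym.
Qed.

(* If p.*2 + 3 = a * b with 3 <= a < b, then [half_run (a - 2)] contains a and
   [half_run (b - 2)] contains b; if a = b >= 5, then [half_run a] contains 2a.
   The excluded p = 3 is the case 3 * 3. *)
Lemma half_runs_composite p : (3 < p)%N -> ~~ prime (p.*2 + 3) ->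
  (p.*2 + 3 %| \prod_(k < p) half_run k)%N.
Proof.
move=> p3 /primePn[|[a /andP[a1 alt] /dvdnP[b def]]]; first by lia.
wlog le_ab : a b a1 alt def / (a <= b)%N => [hw|].
  by case/orP: (leq_total a b) => h; [apply: (hw a b) | apply: (hw b a) => //; nia].
have odd_ab : odd (b * a) by rewrite -def oddD odd_double.
move: odd_ab; rewrite oddM => /andP[ob oa].
have a3 : (2 < a)%N by case: a a1 oa {alt le_ab def} => [|[|[]]].
rewrite def; have [eq_ab|neq_ab] := eqVneq a b.
  rewrite -eq_ab in def *; have a5 : (4 < a)%N.
    by case: a a3 oa def {eq_ab le_ab alt a1} => [|[|[|[|[]]]]] // _ _; lia.
  apply: (@dvdn_half_runs _ _ _ (a - 2) a); try lia; try nia.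
    by apply: dvdn_half_run; lia.
  by apply: dvdn_trans (dvdn_half_run (v := 2 * a) _); [exact: dvdn_mull | lia].
by apply: (@dvdn_half_runs _ _ _ (b - 2) (a - 2)); try (apply: dvdn_half_run; lia); nia.
Qed.

Lemma rising_fact k r : (k`! * \prod_(i < r) (k.+1 + i) = (k + r)`!)%N.
Proof.
elim: r => [|r IHr]; first by rewrite big_ord0 muln1 addn0.
by rewrite big_ord_recr /= mulnA IHr addnS factS mulnC addSn.
Qed.

(** The first factors of the inner products for j = 1, ..., p multiply to p!, which the last inner
    product (p + 1) ... (2p + 1) completes to (2p + 1)!. *)
Lemma prod_rising_fact p :
  (\prod_(j < p.+2) \prod_(i < j) (j + i) = (p.*2.+1)`! * \prod_(j < p) half_run j)%N.
Proof.
have R0 k : (\prod_(i < k.+1) (k.+1 + i) = k.+1 * half_run k)%N.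
  by rewrite big_ord_recl addn0; congr (_ * _)%N; apply: eq_bigr => i _; rewrite addnS.
rewrite big_ord_recr /= [X in (X * _)%N]big_ord_recl /= big_ord0 mul1n.
rewrite (eq_bigr (fun j : 'I_p => j.+1 * half_run j)%N) => [|j _]; last exact: R0.
have factE k : (\prod_(j < k) j.+1 = k`!)%N.
  by elim: k => [|k IHk]; rewrite ?big_ord0 // big_ord_recr /= IHk factS mulnC.
by rewrite big_split /= factE mulnAC rising_fact addnS addnn.
Qed.

(** * Divisibility of the sum for b_n *)

(** The node 0 kills the end terms, and homogeneity extracts the powers of [d]. *)
Lemma det_sum_sqrE m (d : int) :
  det_sum m sqr_nodes (fun i => d * sqr_nodes i)
  = \sum_(k < m) d ^+ k.+1 * ((node_poly sqr_nodes m.+1)`_k.+1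
      * (node_poly sqr_nodes m.+1)`_(m - k)) * \prod_(j < m | j != k) 'C(m.+1, j.+1)%:Z.
Proof.
rewrite /det_sum !node_poly_coef0 ?mulr0 // add0r mul0r add0r.
apply: eq_bigr => k _; rewrite node_poly_scale; last by lia.
have -> : (m.+1 - (m - k) = k.+1)%N by have := ltn_ord k; lia.
by rewrite [_ * (_ * _`_(m - k))]mulrCA.
Qed.

(** Both 'C(m+1, 1) and 'C(m+1, m) equal m + 1, and at most one of them is omitted. *)
Lemma binom_dvd_prod m (k : 'I_m) : (1 < m)%N ->
  (m.+1%:Z %| \prod_(j < m | j != k) 'C(m.+1, j.+1)%:Z)%Z.
Proof.
case: m k => [|[|m]] // k _; have [->|k0] := eqVneq k ord0.
  by rewrite (bigD1 ord_max) //= binSn dvdz_mulr.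
by rewrite (bigD1 ord0) 1?eq_sym //= bin1 dvdz_mulr.
Qed.

(** The node polynomial is X (X + 1) (X + 4) = X^3 + 5 X^2 + 4 X, and 60 = 4 * 5 * 3 with 3 the
    remaining binomial. The next two lemmas are computed likewise. *)
Lemma det_sum_sqr3 d :
  det_sum 2 sqr_nodes (fun i => d * sqr_nodes i) = 60 * (d + d ^+ 2).
Proof.
have q1 : (node_poly sqr_nodes 3)`_1 = 4.
  by rewrite !coef_node_polyS /= /node_poly !big_ord0 !coef1.
have q2 : (node_poly sqr_nodes 3)`_2 = 5.
  by rewrite !coef_node_polyS /= /node_poly !big_ord0 !coef1.
have c1 : 'C(3, 1)%:Z = 3 by [].
have c2 : 'C(3, 2)%:Z = 3 by [].
rewrite det_sum_sqrE !big_ord_recl big_ord0 /= q1 q2 /bump /=.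
rewrite !(big_mkcond (fun j => j != _)) !big_ord_recl !big_ord0 /= /bump /=.
rewrite !add1n ?c1 ?c2; ring.
Qed.

Lemma det_sum_sqr4 d :
  det_sum 3 sqr_nodes (fun i => d * sqr_nodes i)
  = 24 * 14 * 36 * (d + d ^+ 3) + 16 * 49 * 49 * d ^+ 2.
Proof.
have q1 : (node_poly sqr_nodes 4)`_1 = 36.
  by rewrite !coef_node_polyS /= /node_poly !big_ord0 !coef1.
have q2 : (node_poly sqr_nodes 4)`_2 = 49.
  by rewrite !coef_node_polyS /= /node_poly !big_ord0 !coef1.
have q3 : (node_poly sqr_nodes 4)`_3 = 14.
  by rewrite !coef_node_polyS /= /node_poly !big_ord0 !coef1.
have c1 : 'C(4, 1)%:Z = 4 by [].
have c2 : 'C(4, 2)%:Z = 6 by [].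
have c3 : 'C(4, 3)%:Z = 4 by [].
rewrite det_sum_sqrE !big_ord_recl big_ord0 /= q1 q2 q3 /bump /=.
rewrite !(big_mkcond (fun j => j != _)) !big_ord_recl !big_ord0 /= /bump /=.
rewrite !add1n ?c1 ?c2 ?c3; ring.
Qed.

Lemma det_sum_sqr5 d :
  det_sum 4 sqr_nodes (fun i => d * sqr_nodes i)
  = 30 * 576 * 500 * (d + d ^+ 4) + 273 * 820 * 250 * (d ^+ 2 + d ^+ 3).
Proof.
have q1 : (node_poly sqr_nodes 5)`_1 = 576.
  by rewrite !coef_node_polyS /= /node_poly !big_ord0 !coef1.
have q2 : (node_poly sqr_nodes 5)`_2 = 820.
  by rewrite !coef_node_polyS /= /node_poly !big_ord0 !coef1.
have q3 : (node_poly sqr_nodes 5)`_3 = 273.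
  by rewrite !coef_node_polyS /= /node_poly !big_ord0 !coef1.
have q4 : (node_poly sqr_nodes 5)`_4 = 30.
  by rewrite !coef_node_polyS /= /node_poly !big_ord0 !coef1.
have c1 : 'C(5, 1)%:Z = 5 by [].
have c2 : 'C(5, 2)%:Z = 10 by [].
have c3 : 'C(5, 3)%:Z = 10 by [].
have c4 : 'C(5, 4)%:Z = 5 by [].
rewrite det_sum_sqrE !big_ord_recl big_ord0 /= q1 q2 q3 q4 /bump /=.
rewrite !(big_mkcond (fun j => j != _)) !big_ord_recl !big_ord0 /= /bump /=.
rewrite !add1n ?c1 ?c2 ?c3 ?c4; ring.
Qed.

(* For p > 3 every term of [det_sum] is divisible; for p = 1 only the sum is. *)
Lemma half_runs_det_sum_dvd p (d : int) : (0 < p)%N ->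
  (((p.*2 + 3) * (4 * p.+1 * p.+2))%N%:Z
    %| (\prod_(j < p) half_run j)%N%:Z * det_sum p.+1 sqr_nodes (fun i => (d * sqr_nodes i)%R))%Z.
Proof.
move=> p0; rewrite det_sum_sqrE; have [p3|] := ltnP 3 p.
  rewrite mulr_sumr dvdz_sum // => k _.
  set q := node_poly _ _; set c := \prod_(j < _ | _) _.
  (* With n = p + 2 these factors are 2n - 1 and 2n (2n - 2); being coprime, they are treated
     separately. *)
  have cop : coprimez (p.*2 + 3)%N (4 * p.+1 * p.+2)%N.
    rewrite coprimezE !absz_nat !coprimeMr -[4%N]/(2 ^ 2)%N coprimeXr /=; last first.
      by rewrite coprimen2 oddD odd_double.
    rewrite ![coprime (_ + 3) _]coprime_sym /coprime.
    have -> : (p.*2 + 3 = 2 * p.+1 + 1)%N by lia.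
    rewrite gcdnMDl gcdn1; have -> : (2 * p.+1 + 1 = 1 * p.+2 + p.+1)%N by lia.
    by rewrite gcdnMDl -/(coprime _ _) coprimeSn.
  rewrite PoszM Gauss_dvdz // !mulrA; apply/andP; split; last first.
    (* The binomials supply p + 2. The first factors of [half_run p.-1] and [half_run 2] are p + 1
       and 4, and these runs differ because p > 3. *)
    rewrite PoszM dvdz_mul ?binom_dvd_prod //.
    rewrite !dvdz_mulr // dvdzE !absz_nat.
    have -> : (4 * p.+1 = p.+1 * 4)%N by rewrite mulnC.
    by apply: (@dvdn_half_runs _ _ _ p.-1 2); rewrite ?dvdn_half_run //; lia.
  rewrite dvdz_mulr // -mulrA; have [pr|npr] := boolP (prime (p.*2 + 3)).
    rewrite dvdz_mull //; have E : (p.*2 + 3 = (2 * p.+2).-1)%N by lia.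
    (* [node_poly_sqr_dvd] covers the degrees strictly between 1 and n: k + 1 is one of them unless
       k = 0, and then the other degree is n - 1. *)
    have [->|k0] := posnP k.
      by rewrite subn0 dvdz_mull // E node_poly_sqr_dvd -?E //; lia.
    by rewrite dvdz_mulr // E node_poly_sqr_dvd -?E //; have := ltn_ord k; lia.
  by rewrite !dvdz_mulr // dvdzE !absz_nat half_runs_composite.
have mulE (a b c : int) : c = b * a -> (a %| c)%Z by move=> ->; apply: dvdz_mull.
have h0 : half_run 0 = 1%N by rewrite /half_run big_ord0.
have h1 : half_run 1 = 3%N by rewrite /half_run big_ord1.
have h2 : half_run 2 = 20%N by rewrite /half_run !big_ord_recl big_ord0.
rewrite -det_sum_sqrE; case: p p0 => [|[|[|[|]]]] // _ _.
- rewrite det_sum_sqr3 big_ord1 h0 mul1r.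
  (* Here 120 has to divide 60 (d + d^2), and d (d + 1) is even. *)
  have [s ->] : exists s, d + d ^+ 2 = 2 * s.
    have := divz_eq d 2; set r := (d %% 2)%Z; set e := (d %/ 2)%Z => de.
    have [r0|r1] : r = 0 \/ r = 1 by rewrite /r; lia.
      by exists (e * (1 + 2 * e)); rewrite de r0; ring.
    by exists ((2 * e + 1) * (e + 1)); rewrite de r1; ring.
  by apply: (mulE _ s); rewrite -[Posz _]/(120 : int); ring.
- rewrite det_sum_sqr4 !big_ord_recl big_ord0 /= h0 h1.
  apply: (mulE _ (108 * (d + d ^+ 3) + 343 * d ^+ 2)).
  by rewrite -[Posz (1 * _)]/(3 : int) -[Posz _]/(336 : int); ring.
rewrite det_sum_sqr5 !big_ord_recl big_ord0 /= h0 h1 h2.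
apply: (mulE _ (60 * 24 * 500 * (d + d ^+ 4) + 91 * 205 * 250 * (d ^+ 2 + d ^+ 3))).
by rewrite -[Posz (1 * _)]/(60 : int) -[Posz _]/(720 : int); ring.
Qed.

(** * Factorial identities and assembly of the results *)

Lemma prod_fact_split n :
  (\prod_(1 <= k < n.+1) k`! = (\prod_(j < n) j`!) * n`!)%N.
Proof.
rewrite -(big_mkord predT (fun j => j`!)) -big_nat_recr //=.
by rewrite [RHS]big_ltn // mul1n.
Qed.

(** Each (2k - 1)! is (k - 1)! times k (k + 1) ... (2k - 1); the (k - 1)! together with n! form the
    first product on the right. *)
Lemma prod_odd_fact n :
  (n`! * \prod_(1 <= k < n.+1) (2 * k - 1)`!
   = (\prod_(j < n.+1) j`!) * \prod_(j < n.+1) \prod_(i < j) (j + i))%N.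
Proof.
elim: n => [|n IHn]; first by rewrite big_nil !big_ord1 big_ord0.
rewrite big_nat_recr //= big_ord_recr [in RHS](big_ord_recr n.+1) /=.
have -> : (2 * n.+1 - 1 = n + n.+1)%N by lia.
rewrite -(rising_fact n n.+1) factS; move: IHn.
move: (\prod_(1 <= _ < _) _)%N (\prod_(j < n.+1) _)%N => h s.
move: (\prod_(j < n.+1) _)%N (\prod_(_ < _) _)%N => r w IHn.
by transitivity (n.+1 * (n`! * h) * n`! * r)%N; [ring | rewrite IHn; ring].
Qed.

(** With n = p + 3, [det_a_eq] contains s^2, where s = 0! 1! ... (n-1)!. One s goes into the
    denominator; the other is G (n-2)! (n-1)!, with G the product in [det_sum_a_dvd], so n^2 is all
    that G times the sum must supply. *)
Lemma det_a_dvd p (c d : int) : exists t, det_a c d p.+3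
  = d ^+ 'C(p.+3, 2) * ((p.+3 - 2)`! * p.+3 * \prod_(1 <= k < p.+4) k`!)%N%:Z * t.
Proof.
have /dvdzP[t e] := det_sum_a_dvd p c d.
exists ((-1) ^+ 'C(p.+3, 2) * t).
rewrite det_a_eq prod_fact_split factS -[(p.+3 - 2)%N]/(p.+1).
set s := (\prod_(j < p.+3) _)%N.
have sE : s = ((\prod_(j < p.+1) j`!) * p.+1`! * p.+2`!)%N by rewrite /s !big_ord_recr.
set E := det_sum _ _ _ in e *; set G := (\prod_(_ < p.+1) _)%N in e sE.
transitivity ((-1) ^+ 'C(p.+3, 2) * d ^+ 'C(p.+3, 2) * (s * p.+1`! * p.+2`!)%N%:Z * (G%:Z * E)).
  by rewrite -mulnn {2}sE !PoszM; ring.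
by rewrite e -mulnn !PoszM; ring.
Qed.

(** With n = p + 3 and s, w the products in [det_b_eq], the denominator is s^2 w (2n-3)! K, where K
    = (2n-1) 2n (2n-2). As w is (2n-3)! times the half runs, it remains that K divides the half runs
    times the sum. *)
Lemma det_b_dvd p (d : int) : exists t, det_b d p.+3
  = d ^+ 'C(p.+3, 2)
    * (2 * \prod_(1 <= k < p.+4) (k`! * (2 * k - 1)`!))%N%:Z * t.
Proof.
have /dvdzP[t e] := half_runs_det_sum_dvd d (isT : (0 < p.+1)%N).
exists ((-1) ^+ 'C(p.+3, 2) * t).
rewrite det_b_eq big_split /= prod_fact_split [(\prod_(1 <= k < p.+4) _)%N]big_nat_recr //=.
have := prod_odd_fact p.+2; have := prod_rising_fact p.+1.
set s := (\prod_(j < p.+3) j`!)%N; set w := (\prod_(j < p.+3) _)%N.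
set h := (\prod_(1 <= k < p.+3) _)%N; set r := (\prod_(_ < _) _)%N in e *.
move=> wE hE; set K := (_ * _)%N in e.
have KE : (2 * p.+3 * (2 * p.+3 - 1)`! = (p.+1.*2.+1)`! * K)%N.
  have -> : (2 * p.+3 - 1 = p.+1.*2.+3)%N by lia.
  by rewrite 2!factS /K -addnn; ring.
have -> : (2 * (s * p.+3`! * (h * (2 * p.+3 - 1)`!)) = s * s * w * (p.+1.*2.+1)`! * K)%N.
  transitivity (s * (p.+2`! * h) * (2 * p.+3 * (2 * p.+3 - 1)`!))%N.
    by rewrite [p.+3`!]factS; ring.
  by rewrite KE hE; ring.
set E := det_sum _ _ _ in e *; set z := (p.+1.*2.+1)`! in wE *.
transitivity ((-1) ^+ 'C(p.+3, 2) * d ^+ 'C(p.+3, 2) * (s * s * w * z)%N%:Z * (r%:Z * E)).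
  by rewrite -mulnn {2}wE !PoszM; ring.
by rewrite e !PoszM; ring.
Qed.

Lemma scaled_quotient_int (D d t : int) N (den : nat) : d != 0 -> (0 < den)%N ->
  D = d ^+ N * den%:Z * t -> D%:~R * d%:~R ^- N / den%:R \is a @Num.int rat.
Proof.
move=> d0 den0 ->; rewrite !rmorphM rmorphXn /=.
suff -> : d%:~R ^+ N * den%:~R * t%:~R * d%:~R ^- N / den%:R = t%:~R :> rat.
  exact: intr_int.
have dN0 : d%:~R ^+ N != 0 :> rat by rewrite expf_neq0 // intr_eq0.
have den0' : den%:R != 0 :> rat by rewrite pnatr_eq0 -lt0n.
by rewrite -pmulrn; field; apply/andP.
Qed.

Lemma signed_scaled_gt0 (D d E : int) N (w : nat) : 0 < d -> (0 < w)%N -> 0 < E ->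
  D = (-1) ^+ N * d ^+ N * (w ^ 2)%N%:Z * E -> 0 < (-1) ^+ N * D.
Proof.
move=> d0 w0 E0 ->; rewrite !mulrA -expr2 sqrr_sign mul1r.
by rewrite !mulr_gt0 ?exprn_gt0 // ltz_nat expn_gt0 w0.
Qed.

Theorem theorem1p2 (c d : int) (n : nat) (hd : d != 0) (hn : (2 < n)%N) :
  [/\ det_a' c d n \is a Num.int /\ det_b' d n \is a Num.int,
      (d ^+ (n * (n - 1) %/ 2) * n%:Z ^+ 2 %| det_a c d n)%Z
      /\ (d ^+ (n * (n - 1) %/ 2) * ((2 * n)`!)%:Z %| det_b d n)%Z
    & 0 < d -> 0 <= c ->
      0 < (-1) ^+ (n * (n - 1) %/ 2) * det_a c d n
      /\ 0 < (-1) ^+ (n * (n - 1) %/ 2) * det_b d n].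
Proof.
have binE : (n * (n - 1) %/ 2 = 'C(n, 2))%N by rewrite bin2 divn2 subn1.
rewrite /det_a' /det_b' binE; case: n hn {binE} => [|[|[|p]]] // _.
have fact_gt k : (0 < \prod_(j < k) j`!)%N by apply: prodn_gt0 => j; apply: fact_gt0.
have rise_gt k : (0 < \prod_(j < k) \prod_(i < j) (j + i))%N.
  by apply: prodn_gt0 => j; apply: prodn_gt0 => i; have := ltn_ord i; lia.
have [t at_] := det_a_dvd p c d; have [u bu] := det_b_dvd p d; split.
- split.
    apply: scaled_quotient_int at_ => //.
    by rewrite prod_fact_split !muln_gt0 !fact_gt0 fact_gt.
  apply: scaled_quotient_int bu => //.
  rewrite muln_gt0 big_split /= prod_fact_split !muln_gt0 fact_gt fact_gt0 /=.
  by rewrite prodn_gt0 // => k; rewrite fact_gt0.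
- split.
    rewrite at_ dvdz_mulr // dvdz_mul // dvdzE abszX !absz_nat prod_fact_split.
    by rewrite factS; apply/dvdnP; exists ((p.+3 - 2)`! * (\prod_(j < p.+3) j`!) * p.+2`!)%N; ring.
  rewrite bu dvdz_mulr // dvdz_mul // dvdzE !absz_nat.
  (* The denominator supplies its leading 2, the n in n! and its last odd factorial (2n - 1)!. *)
  have -> : ((2 * p.+3)`! = 2 * p.+3 * (2 * p.+3 - 1)`!)%N.
    by rewrite -(prednK (isT : 0 < 2 * p.+3)%N) factS subn1.
  rewrite big_nat_recr //=.
  rewrite [p.+3`!]factS; apply/dvdnP.
  by exists ((\prod_(1 <= k < p.+3) (k`! * (2 * k - 1)`!)) * p.+2`!)%N; ring.
move=> d0 c0; split.
  apply: signed_scaled_gt0 (det_a_eq c d p.+2) => //.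
  by apply: det_sum_gt0 => // [|i||i]; rewrite ?mulr0 ?mulr_gt0 //; lia.
apply: signed_scaled_gt0 (det_b_eq d p.+2) => //; first by rewrite muln_gt0 fact_gt rise_gt.
by apply: det_sum_gt0 => // [|i]; rewrite /sqr_nodes ?mulr_gt0 ?exprn_gt0 //
  mulr_ge0 // ltW.
Qed.
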